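(* Consider the closed-loop inverter model $$\dot\xi=v_{dc}-v_{dc,\mathrm{ref}},$$ $$(C_{dc}+K_d)\dot v_{dc}=-G_{dc}v_{dc}+i_{dc,\mathrm{ref}}-K_p(v_{dc}-v_{dc,\mathrm{ref}})-K_i\xi-\tfrac{\mu}{2}\mathbf{e}_2^\top i_{dq},$$ $$L\,\dot i_{dq}=-(R\boldsymbol{I}+v_{dc}\eta L\boldsymbol{J})i_{dq}+\tfrac{\mu}{2}\mathbf{e}_2v_{dc}-v_{dq},$$ $$C\,\dot v_{dq}=-(G\boldsymbol{I}+v_{dc}\eta C\boldsymbol{J})v_{dq}-s_{l,dq}+i_{dq},$$ with constant load current $s_{l,dq}\in\mathbb{R}^2$ and modulation amplitude given by the voltage droop control $$\mu=\mu_{\mathrm{ref}}+d_v(P_l-P_{\mathrm{ref}}),\qquad P_l=s_{l,dq}^\top v_{dq}.$$ Assume that this closed loop admits a steady state $(\xi^*,v_{dc}^*,i_{dq}^*,v_{dq}^* )$ (i.e. $(\tilde\xi,\tilde v_{dc},\tilde i_{dq},\tilde v_{dq})=0$ in the error coordinates relative to it). Assuming that $$\frac{C^2\lVert v_{dq}^*\rVert^2}{4G}+\frac{L^2\lVert i_{dq}^*\rVert^2}{4R}<\frac{G_{dc}}{\eta^2}$$ holds, then for a sufficiently small droop coefficient $d_v>0$ this steady state is globally asymptotically stable for the closed loop.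
   Context: Here $\boldsymbol{I}$ is the $2\times2$ identity, $\boldsymbol{J}=\begin{bmatrix}0&-1\\1&0\end{bmatrix}$, $\mathbf{e}_2=\begin{bmatrix}0\\1\end{bmatrix}$, $\lVert\cdot\rVert$ is the Euclidean norm, with $\omega_0>0$, $v_{dc,\mathrm{ref}}>0$ and $\eta=\omega_0/v_{dc,\mathrm{ref}}$. The parameters $C_{dc},G_{dc},L,R,C,G,K_p,K_i,K_d,i_{dc,\mathrm{ref}}>0$ are constants. The state is $(\xi,v_{dc},i_{dq},v_{dq})\in\mathbb{R}\times\mathbb{R}\times\mathbb{R}^2\times\mathbb{R}^2$. $\mu_{\mathrm{ref}}=2r_{\mathrm{ref}}/v_{dc,\mathrm{ref}}$, where $r_{\mathrm{ref}}>0$ and $P_{\mathrm{ref}}$ are constant set-points for the AC voltage amplitude and load power, $d_v>0$ is the droop coefficient, and $P_l=i_{l,dq}^\top v_{dq}$ is the load power, where the load current is $i_{l,dq}=s_{l,dq}$. Tildes denote errors with respect to the starred steady-state values. *)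

(* Defs.v *)
From HB Require Import structures.
From mathcomp Require Import all_boot all_order all_algebra.
From mathcomp Require Import all_classical all_reals all_analysis.
Import numFieldNormedType.Exports.
Import Order.TTheory GRing.Theory Num.Theory.

Set Implicit Arguments.
Unset Strict Implicit.
Unset Printing Implicit Defensive.

Local Open Scope classical_set_scope.
Local Open Scope ring_scope.

Section Plane.
Context {R : realType}.

Definition J : 'M[R]_2 := delta_mx 1 0 - delta_mx 0 1.
Definition e2 : 'cV[R]_2 := delta_mx 1 0.
Definition dot (u w : 'cV[R]_2) : R := (u^T *m w) 0 0.

(* The library norm `|u| on matrices is the maximum norm. *)
Definition enorm (u : 'cV[R]_2) : R := Num.sqrt (dot u u).

End Plane.

Section Stability.
Context {R : realType} {V : normedModType R}.
Implicit Types (f : V -> V) (x : R -> V) (p : V).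

(* Values of x at negative times are irrelevant; at t = 0 only continuity from
   the right is asked, so the right derivative at 0 is f (x 0) as soon as f is
   continuous. *)
Definition solution f x : Prop :=
  {within `[0, +oo[, continuous x} /\
  forall t : R, 0 < t -> is_derive t 1 x (f (x t)).

Definition equilibrium f p : Prop := f p = 0.

Definition forward_complete f : Prop :=
  forall x0 : V, exists x, solution f x /\ x 0 = x0.

Definition lyapunov_stable f p : Prop :=
  forall e : R, 0 < e -> exists2 d : R, 0 < d &
    forall x, solution f x -> `|x 0 - p| < d ->
    forall t : R, 0 <= t -> `|x t - p| < e.

Definition globally_attractive f p : Prop :=
  forall x, solution f x -> x t @[t --> +oo] --> p.

(* Forward completeness is part of the notion: without it, trajectories escaping
   in finite time would not be constrained by the other clauses.  Intended for
   locally Lipschitz f, where trajectories are unique. *)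
Definition globally_asymptotically_stable f p : Prop :=
  [/\ equilibrium f p, forward_complete f,
      lyapunov_stable f p & globally_attractive f p].

End Stability.

(* Lf, Rf, Cf, Gf are the AC-side L, R, C, G. *)
Record inverter (R : realType) := Inverter {
  C_dc : R; G_dc : R; Lf : R; Rf : R; Cf : R; Gf : R;
  K_p : R; K_i : R; K_d : R;
  i_dc_ref : R; v_dc_ref : R; omega0 : R; r_ref : R; P_ref : R;
  C_dc_gt0 : 0 < C_dc; G_dc_gt0 : 0 < G_dc;
  Lf_gt0 : 0 < Lf; Rf_gt0 : 0 < Rf; Cf_gt0 : 0 < Cf; Gf_gt0 : 0 < Gf;
  K_p_gt0 : 0 < K_p; K_i_gt0 : 0 < K_i; K_d_gt0 : 0 < K_d;
  i_dc_ref_gt0 : 0 < i_dc_ref; v_dc_ref_gt0 : 0 < v_dc_ref;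
  omega0_gt0 : 0 < omega0; r_ref_gt0 : 0 < r_ref
}.

Section ClosedLoop.
Context {R : realType}.
Variable m : inverter R.

Definition eta : R := omega0 m / v_dc_ref m.
Definition mu_ref : R := 2 * r_ref m / v_dc_ref m.

(* (xi, v_dc, i_dq, v_dq) *)
Definition state : Type := (R * R * 'cV[R]_2 * 'cV[R]_2)%type.

Definition load_power (s v : 'cV[R]_2) : R := dot s v.

Definition droop (dv : R) (s v : 'cV[R]_2) : R :=
  mu_ref + dv * (load_power s v - P_ref m).

Definition closed_loop (s : 'cV[R]_2) (dv : R) (x : state) : state :=
  let: (xi, vdc, i, v) := x in
  let mu := droop dv s v in
  (vdc - v_dc_ref m,
   (C_dc m + K_d m)^-1 *
     (- G_dc m * vdc + i_dc_ref m - K_p m * (vdc - v_dc_ref m)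
      - K_i m * xi - mu / 2 * dot e2 i),
   (Lf m)^-1 *:
     (- (((Rf m)%:M + (vdc * eta * Lf m) *: J) *m i)
      + (mu / 2 * vdc) *: e2 - v),
   (Cf m)^-1 *:
     (- (((Gf m)%:M + (vdc * eta * Cf m) *: J) *m v) - s + i)).

End ClosedLoop.

(* Main.v *)
Require Import Defs.
From mathcomp Require Import all_boot all_order all_algebra.
From mathcomp Require Import all_classical all_reals all_analysis.
From mathcomp Require Import ring lra.
Import numFieldNormedType.Exports.
Import Order.TTheory GRing.Theory Num.Theory.
Local Open Scope classical_set_scope.
Local Open Scope ring_scope.

(** Write errors with respect to the steady state as (x, u, i, v), and let nu be
    the variation of the modulation amplitude that the droop law produces, a
    linear function of v times the droop coefficient.  The energy
      H = (K_i x^2 + (C_dc + K_d) u^2 + L |i|^2 + C |v|^2) / 2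
    has the following property ([energy_rate]): the rotations do no work on the
    errors and the bilinear exchange of power nu u i_2 between the two sides of
    the converter cancels.  Hence dH/dt is a quadratic form in (u, i, v), equal
    to minus the losses (G_dc + K_p) u^2 + R |i|^2 + G |v|^2, plus the cross
    terms created by the steady-state current and voltage in the rotating frame,
    plus terms of the order of the droop coefficient.  The assumed inequality
    says exactly that the losses without K_p u^2 absorb the rotation terms, by
    Young's inequality.  The extra K_p u^2 thus leaves a margin that depends
    neither on the steady state nor on the droop coefficient.  The assumed
    inequality also bounds the steady-state current, and the steady-state DC
    voltage is its set-point, so that the droop terms are at most a constant
    times the droop coefficient.  One threshold therefore serves all
    steady states, although these move with the droop coefficient
    ([uniform_dissipation]).

    Along solutions H does not increase, which gives Lyapunov stability.  Since
    H controls the norm, it also gives forward completeness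
    ([forward_complete_of_dissipative]): the vector field is precomposed with a
    radial retraction onto a large ball, which makes it bounded and Lipschitz,
    hence globally solvable ([picard_lindelof_bounded]); the retraction only
    rescales the error, so H still decreases, the solution stays in the ball and
    solves the original system.

    The dissipation does not see the integrator error x.  Adding to H a small
    multiple eps of (C_dc + K_d) x u repairs this: its derivative contains
    - K_i x^2, and the other terms are dominated by the dissipation on each
    sublevel set of H when eps is small depending on the level.  As every
    trajectory stays in one sublevel set of H, the corrected energy decays
    exponentially along it ([strict_decay],
    [globally_attractive_of_strict]). *)

Set Implicit Arguments.
Unset Strict Implicit.
Unset Printing Implicit Defensive.

(** * Derivatives and limits of scalar functions *)

Section Real.
Context {R : realType}.

Lemma is_derive1P (V : normedModType R) (x : R -> V) (t : R) (v : V) :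
  is_derive t 1 x v <->
  h^-1 *: (x (h + t) - x t) @[h --> 0^'] --> v.
Proof.
have E : (fun h : R => h^-1 *: (x (h + t) - x t)) =
         (fun h => h^-1 *: ((x \o shift t) (h *: 1) - x t)).
  by apply/funext => h; rewrite /= /shift/= /GRing.scale/= mulr1.
rewrite E; split=> [[dx <-]|xv]; first exact: dx.
split; first by apply/cvg_ex; exists v.
exact: (cvg_lim (@norm_hausdorff _ _) xv).
Qed.

Lemma primitive_continuous (f : R -> R) :
  continuous f ->
  exists F : R -> R, F 0 = 0 /\ forall t : R, 0 <= t -> is_derive t 1 F (f t).
Proof.
move=> cf.
(* Starting at -1 rather than 0 makes the derivative at 0 two-sided. *)
pose G (x : R) : R := (\int[lebesgue_measure]_(t in [set` `[-1, x]]) f t)%R.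
have dG (t : R) : 0 <= t -> is_derive t 1 G (f t).
  move=> t0.
  have t1 : t < t + 1 by rewrite ltrDl.
  have fi : lebesgue_measure.-integrable `[-1, t + 1] (EFin \o f).
    apply: continuous_compact_integrable; first exact: segment_compact.
    exact: continuous_subspaceT.
  have t1' : -1 < t by exact: (lt_le_trans _ t0).
  have [dG GE] := continuous_FTC1_closed t1 fi t1' (cf t).
  by split => //; rewrite -derive1E GE.
exists (fun t : R => G t - G 0); split; first exact: subrr.
move=> t t0.
have -> : (fun t : R => G t - G 0) = G - cst (G 0) by [].
by rewrite -[f t]subr0; apply: is_deriveB; exact: dG.
Qed.

Lemma nonincreasing_of_derive (y y' : R -> R) :
  {within `[0, +oo[, continuous y} ->
  (forall t : R, 0 < t -> is_derive t 1 y (y' t)) ->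
  (forall t : R, 0 < t -> y' t <= 0) ->
  forall s t, 0 <= s -> s <= t -> y t <= y s.
Proof.
move=> cy dy y'0 s t; apply: (@ler0_derive1_nincry _ y 0) => //= r.
  by rewrite in_itv/= andbT => /dy[].
by rewrite in_itv/= andbT derive1E => r0; have [_ ->] := dy r r0; exact: y'0.
Qed.

Lemma derive_within_continuous (V : normedModType R) (x x' : R -> V) :
  (forall t : R, 0 <= t -> is_derive t 1 x (x' t)) ->
  {within `[0, +oo[, continuous x}.
Proof.
move=> dx; apply: derivable_within_continuous => t.
by rewrite in_itv/= andbT => /dx[].
Qed.

(** Passage to the limit in an estimate with an error of order 2^-n. *)
Lemma le_of_geometric_error (a b c : R) :
  (forall n, a <= b + c / 2 ^+ n) -> a <= b.
Proof.
move=> H; rewrite leNgt; apply/negP => ab.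
have [c0|c0] := lerP c 0.
  have := H 0%N; rewrite expr0 divr1; lra.
have [n nP] : exists n, c / (a - b) < n%:R :> R.
  by exists (Num.truncn (c / (a - b))).+1; rewrite truncnS_gt.
have := H n.
have : (n%:R : R) <= 2 ^+ n by rewrite -natrX ler_nat ltnW// ltn_expl.
have : (0 : R) < 2 ^+ n by rewrite exprn_gt0.
move: nP; rewrite ltr_pdivrMr; last lra.
move=> h1 h2 h3.
rewrite -lerBlDl ler_pdivlMr//; nra.
Qed.

(** The sequences u_n -+ 2 C / 2^n are monotone and enclose u_n, so the supremum
    of the lower one is the limit; this yields the explicit rate at once. *)
Lemma geometric_limit (u : nat -> R) (C : R) : 0 <= C ->
  (forall n, `|u n.+1 - u n| <= C / 2 ^+ n) ->
  exists l, forall n, `|u n - l| <= 2 * C / 2 ^+ n.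
Proof.
move=> C0 uC.
pose a n := u n - 2 * C / 2 ^+ n; pose b n := u n + 2 * C / 2 ^+ n.
have half n : 2 * C / 2 ^+ n.+1 = C / 2 ^+ n.
  by rewrite exprS; field; rewrite expf_neq0.
have eh n : 2 * C / 2 ^+ n = C / 2 ^+ n + C / 2 ^+ n by ring.
have p2 n : 0 <= C / 2 ^+ n by rewrite divr_ge0// exprn_ge0.
have anS n : a n <= a n.+1.
  by rewrite /a half eh; have := uC n; rewrite ler_norml => /andP[]; lra.
have bnS n : b n.+1 <= b n.
  by rewrite /b half eh; have := uC n; rewrite ler_norml => /andP[]; lra.
have ha m n : (m <= n)%N -> a m <= a n.
  by apply: (homo_leq (r := fun x y => x <= y)) => // y x z; apply: le_trans.
have hb m n : (m <= n)%N -> b n <= b m.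
  by apply: (homo_leq (r := fun x y => y <= x)) => // y x z yx zy; apply: le_trans yx.
have ab m n : a m <= b n.
  apply: le_trans (ha _ _ (leq_maxl m n)) _.
  apply: le_trans (hb _ _ (leq_maxr m n)).
  by rewrite /a /b eh; have := p2 (maxn m n); lra.
exists (sup (range a)) => n.
have : a n <= sup (range a).
  apply: ub_le_sup; last by exists n.
  by exists (b 0%N) => _ [m _ <-].
have : sup (range a) <= b n.
  apply: ge_sup; first by exists (a 0%N), 0%N.
  by move=> _ [m _ <-].
by rewrite ler_norml /a /b => h1 h2; apply/andP; split; lra.
Qed.

End Real.

(** * Normed spaces with sup-norm coordinates *)

(** V is, through the coordinates c, isometric to a finite power of the reals with
    the maximum norm.  Products of real lines and matrix spaces have this form,
    and it reduces derivatives, primitives, completeness and Lipschitz estimates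
    to real functions. *)
Record sup_coordinates (R : realType) (V : normedModType R) (I : finType)
    (c : I -> V -> R) : Prop := SupCoordinates {
  coord_linear : forall i (a : R) (x y : V),
    c i (a *: x + y) = a * c i x + c i y;
  coord_norm_le : forall (x : V) (r : R), 0 <= r ->
    (`|x| <= r <-> forall i, `|c i x| <= r);
  coord_surj : forall y : I -> R, exists x, forall i, c i x = y i }.

Section Coordinates.
Context {R : realType} {V : normedModType R} {I : finType} {c : I -> V -> R}.
Hypothesis cV : sup_coordinates c.
Implicit Types (x y v : V) (X Y : R -> V).

Lemma coordD i x y : c i (x + y) = c i x + c i y.
Proof. by have := coord_linear cV i 1 x y; rewrite scale1r mul1r. Qed.

Lemma coord0 i : c i 0 = 0.
Proof. by apply: (addIr (c i 0)); rewrite -coordD !add0r. Qed.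

Lemma coordZ i (a : R) x : c i (a *: x) = a * c i x.
Proof. by have := coord_linear cV i a x 0; rewrite !addr0 coord0 addr0. Qed.

Lemma coordB i x y : c i (x - y) = c i x - c i y.
Proof. by rewrite coordD -scaleN1r coordZ mulN1r. Qed.

Lemma le_coord_norm i x : `|c i x| <= `|x|.
Proof. by move: i; apply/coord_norm_le. Qed.

Lemma coord_inj x y : (forall i, c i x = c i y) -> x = y.
Proof.
move=> xy; apply/eqP; rewrite -subr_eq0 -normr_le0.
by apply/(coord_norm_le cV) => // i; rewrite coordB xy subrr normr0.
Qed.

Lemma coord_continuous i : continuous (c i).
Proof.
move=> x; apply/cvgrPdist_le => e e0.
near=> y; rewrite -coordB (le_trans (le_coord_norm _ _))//.
Unshelve. all: end_near. Qed.

Lemma is_derive_coordP X (t : R) v :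
  is_derive t 1 X v <-> forall i, is_derive t 1 (c i \o X) (c i v).
Proof.
rewrite is_derive1P; split=> [Xv i|Xv].
  rewrite is_derive1P /=.
  have -> : (fun h : R => h^-1 *: (c i (X (h + t)) - c i (X t))) =
            c i \o (fun h : R => h^-1 *: (X (h + t) - X t)).
    by apply/funext => h /=; rewrite coordZ coordB.
  apply: cvg_comp; first exact: Xv.
  exact: coord_continuous.
apply/cvgrPdist_le => e e0; near=> h.
apply/(coord_norm_le cV); first exact: ltW.
move=> i; rewrite coordB coordZ coordB; move: i; near: h.
apply: filter_forall => i.
by have /is_derive1P/cvgrPdist_le/(_ _ e0) := Xv i.
Unshelve. all: by end_near. Qed.

Lemma primitive_of_lipschitz (h : R -> V) (K : R) (v : V) :
  (forall s t, `|h s - h t| <= K * `|s - t|) ->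
  exists F : R -> V, F 0 = v /\ forall t : R, 0 <= t -> is_derive t 1 F (h t).
Proof.
move=> hK.
have ch : continuous h.
  move=> x; apply/cvgrPdist_le => e e0; near=> y.
  apply: le_trans (hK _ _) _.
  have K1 : 0 < `|K| + 1 by rewrite ltr_wpDl.
  apply: (@le_trans _ _ ((`|K| + 1) * `|x - y|)).
    by rewrite ler_wpM2r// (le_trans (ler_norm K))// lerDl.
  rewrite mulrC -ler_pdivlMr//; near: y; apply: cvgr_dist_le => //.
  exact: divr_gt0.
have /choice[F FP] : forall i, exists F : R -> R,
    F 0 = 0 /\ forall t : R, 0 <= t -> is_derive t 1 F (c i (h t)).
  move=> i; apply: (@primitive_continuous _ (c i \o h)) => t.
  by apply: continuous_comp; [exact: ch|exact: coord_continuous].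
have /choice[G GP] : forall t, exists x, forall i, c i x = F i t + c i v.
  by move=> t; exact: (coord_surj cV (fun i => F i t + c i v)).
exists G; split.
  by apply: coord_inj => i; rewrite GP (FP i).1 add0r.
move=> t t0; apply/is_derive_coordP => i.
have -> : c i \o G = F i + cst (c i v) by apply/funext => s; rewrite /= GP.
rewrite -[c i (h t)]addr0; have := (FP i).2 t t0.
by move=> ?; apply: is_deriveD.
Unshelve. all: by end_near. Qed.

(** This replaces estimates on vector-valued integrals: each coordinate of X, up to
    sign, minus phi is nonincreasing. *)
Lemma mean_value_inequality (X X' : R -> V) (phi phi' : R -> R) :
  (forall t : R, 0 <= t -> is_derive t 1 X (X' t)) ->
  (forall t : R, 0 <= t -> is_derive t 1 phi (phi' t)) ->
  (forall t : R, 0 <= t -> `|X' t| <= phi' t) ->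
  forall s t : R, 0 <= s -> s <= t -> `|X t - X s| <= phi t - phi s.
Proof.
move=> dX dphi X'phi s t s0 st.
have key (Y Y' : R -> R) :
    (forall t : R, 0 <= t -> is_derive t 1 Y (Y' t)) ->
    (forall t : R, 0 <= t -> Y' t <= phi' t) -> Y t - Y s <= phi t - phi s.
  move=> dY Y'phi.
  have d (r : R) : 0 <= r -> is_derive r 1 (Y - phi) (Y' r - phi' r).
    by move=> r0; have := dY r r0; have := dphi r r0 => ? ?; apply: is_deriveB.
  have := @nonincreasing_of_derive _ (Y - phi) (fun r => Y' r - phi' r)
    (derive_within_continuous d) (fun r r0 => d r (ltW r0)).
  have H (r : R) : 0 < r -> Y' r - phi' r <= 0.
    by move=> r0; rewrite subr_le0 Y'phi// ltW.
  by move=> /(_ H s t s0 st); rewrite !fctE; lra.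
have b0 : 0 <= phi t - phi s.
  have := key (cst 0) (cst 0); rewrite /= subrr; apply.
  by move=> r r0; exact: le_trans (X'phi r r0).
apply/(coord_norm_le cV) => // i; rewrite coordB ler_norml.
have dXi (r : R) : 0 <= r -> is_derive r 1 (c i \o X) (c i (X' r)).
  by move=> r0; have /is_derive_coordP := dX r r0.
have X'i (r : R) : 0 <= r -> `|c i (X' r)| <= phi' r.
  by move=> r0; exact: le_trans (le_coord_norm _ _) (X'phi r r0).
apply/andP; split.
- have := key (- (c i \o X)) (fun r => - c i (X' r)); rewrite !fctE /= => H.
  rewrite lerNl opprB (le_trans _ (H _ _))//; first by rewrite opprK addrC.
    by move=> r r0; have := dXi r r0 => ?; apply: is_deriveN.
  by move=> r r0; rewrite lerNl; have := X'i r r0; rewrite ler_norml => /andP[].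
- have := key (c i \o X) (fun r => c i (X' r)) dXi; rewrite /=; apply.
  by move=> r r0; exact: le_trans (ler_norm _) (X'i r r0).
Qed.

End Coordinates.

(** * Global solutions for bounded Lipschitz vector fields *)

Lemma is_derive_scale (R : realType) (a t : R) :
  is_derive t 1 (fun s : R => a * s) a.
Proof.
have := @is_deriveZ R R R id a t 1 1 (is_derive_id _ _).
by rewrite [X in is_derive _ _ _ X]mulr1.
Qed.

Lemma is_derive_scale_expR (R : realType) (a k t : R) :
  is_derive t 1 (fun s : R => a * expR (k * s)) (a * (k * expR (k * t))).
Proof.
have dk := is_derive_scale k t.
have de := @is_derive1_comp R expR (fun s => k * s) t _ _
  (is_derive_expR _) dk.
have := @is_deriveZ R R R _ a t 1 _ de.
by rewrite [X in is_derive _ _ _ (_ *: X)]mulrC.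
Qed.

Section Picard.
Context {R : realType} {V : normedModType R} {I : finType} {c : I -> V -> R}.
Hypothesis cV : sup_coordinates c.

Lemma lipschitz_of_derive_bounded (X X' : R -> V) (B : R) :
  (forall t : R, 0 <= t -> is_derive t 1 X (X' t)) ->
  (forall t : R, 0 <= t -> `|X' t| <= B) ->
  forall s t : R, 0 <= s -> 0 <= t -> `|X s - X t| <= B * `|s - t|.
Proof.
move=> dX X'B s t; wlog st : s t / t <= s => [H s0 t0|s0 t0].
  have [/H->//|/ltW/H] := leP t s.
  by rewrite distrC [in X in _ -> _ <= X]distrC; apply.
rewrite [`|s - t|]ger0_norm ?subr_ge0// mulrBr.
exact: (mean_value_inequality cV dX (fun r _ => is_derive_scale B r)).
Qed.

(** Picard iteration.  For the distance sup |Y t - Z t| / exp (2 K t), the map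
    sending Y to the primitive of g o Y halves distances, so the iterates converge at a
    geometric rate on the whole half-line, with no need to concatenate local
    solutions.  All iterates are B-Lipschitz, and so is the limit, which is
    therefore continuous and can be substituted into g. *)
Lemma picard_lindelof_bounded (g : V -> V) (B K : R) (x0 : V) : 0 < K ->
  (forall x, `|g x| <= B) ->
  (forall x y, `|g x - g y| <= K * `|x - y|) ->
  exists X : R -> V, X 0 = x0 /\
    forall t : R, 0 <= t -> is_derive t 1 X (g (X t)).
Proof.
move=> K0 gB gK.
have B0 : 0 <= B by exact: le_trans (gB x0).
pose adm (Y : R -> V) := forall s t : R, 0 <= s -> 0 <= t ->
  `|Y s - Y t| <= B * `|s - t|.
have /choice[T TP] : forall Y, exists F : R -> V, adm Y ->
    F 0 = x0 /\ forall t : R, 0 <= t -> is_derive t 1 F (g (Y t)).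
  move=> Y.
  have [admY|nadmY] := pselect (adm Y); last by exists Y => /nadmY.
  (* Y is only controlled on the half-line; the absolute value extends it evenly. *)
  have [s t|F [F0 dF]] := @primitive_of_lipschitz _ _ _ _ cV
      (fun t => g (Y `|t|)) (K * B) x0.
    rewrite (le_trans (gK _ _))// -mulrA ler_pM2l//.
    rewrite (le_trans (admY _ _ _ _))// ler_wpM2l//.
    exact: ler_dist_dist.
  by exists F => _; split => // t t0; have := dF t t0; rewrite ger0_norm.
have admT Y : adm Y -> adm (T Y).
  by move=> /TP[_ dT]; apply: (lipschitz_of_derive_bounded dT) => t _.
pose X n := iter n T (cst x0).
have admX n : adm (X n).
  elim: n => [|n IH]; last exact: admT.
  by move=> s t _ _; rewrite /= subrr normr0 mulr_ge0.
(* The first increment has speed at most B <= B exp (2 K t), the derivative of C w. *)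
pose C := B / (2 * K); pose w (t : R) := expR (2 * K * t).
have C0 : 0 <= C by rewrite divr_ge0// mulr_ge0// ltW.
have w0 t : 0 <= w t by exact: expR_ge0.
have p2 n : 0 < 2 ^+ n :> R by rewrite exprn_gt0.
(* The distance of the two images grows at most at the rate K (2 D w) = (D w)'. *)
have contract (Y Z : R -> V) (D : R) : adm Y -> adm Z ->
    (forall t : R, 0 <= t -> `|Y t - Z t| <= 2 * D * w t) -> 0 <= D ->
    forall t : R, 0 <= t -> `|T Y t - T Z t| <= D * w t.
  move=> /TP[TY0 dTY] /TP[TZ0 dTZ] YZ D0 t t0.
  have dYZ (r : R) : 0 <= r -> is_derive r 1 (T Y - T Z) (g (Y r) - g (Z r)).
    by move=> r0; have := dTY r r0; have := dTZ r r0 => ? ?; apply: is_deriveB.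
  have := mean_value_inequality cV dYZ
    (fun r _ => is_derive_scale_expR D (2 * K) r) _ (lexx 0) t0.
  rewrite !fctE TY0 TZ0 subrr subr0 => /(_ _)/le_trans; apply.
    move=> r r0; apply: le_trans (gK _ _) _.
    rewrite (_ : D * _ = K * (2 * D * w r)); last by rewrite /w; ring.
    by rewrite ler_pM2l// YZ.
  by rewrite gerBl mulr_ge0// expR_ge0.
have XS n t : 0 <= t -> `|X n.+1 t - X n t| <= C / 2 ^+ n * w t.
  elim: n t => [|n IH] t t0.
    have [TX0 dTX] := TP _ (admX 0%N).
    have := mean_value_inequality cV dTX
      (fun r _ => is_derive_scale_expR C (2 * K) r) _ (lexx 0) t0.
    rewrite TX0 divr1 => /(_ _)/le_trans; apply.
      move=> r r0; apply: le_trans (gB _) _.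
      rewrite mulrA /C divfK ?mulf_neq0 ?gt_eqF//.
      rewrite ler_peMr// -expR0 ler_expR mulr_ge0// mulr_ge0// ltW//.
    by rewrite gerBl mulr_ge0// expR_ge0.
  apply: (contract _ _ _ (admX n.+1) (admX n)) => // [r r0|].
    by have := IH r r0; rewrite exprS; congr (_ <= _ * _); field; rewrite gt_eqF.
  by rewrite divr_ge0// ltW.
have /choice[Y YP] : forall t : R, exists l, 0 <= t ->
    forall n, `|X n t - l| <= 2 * (C * w t) / 2 ^+ n.
  move=> t.
  have [t0|] := boolP (0 <= t); last by exists x0.
  have Ct0 : 0 <= C * w t by exact: mulr_ge0.
  have /choice[l lP] : forall i, exists l,
      forall n, `|c i (X n t) - l| <= 2 * (C * w t) / 2 ^+ n.
    move=> i; apply: geometric_limit => // n.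
    rewrite -(coordB cV) (le_trans (le_coord_norm cV _ _))//.
    by rewrite mulrAC XS.
  have [x xl] := coord_surj cV l.
  exists x => _ n; apply/(coord_norm_le cV).
    by rewrite divr_ge0 ?exprn_ge0// mulr_ge0.
  by move=> i; rewrite (coordB cV) xl.
have admY : adm Y.
  move=> s t s0 t0.
  apply: (@le_of_geometric_error _ _ _ (2 * (C * w s) + 2 * (C * w t))) => n.
  have -> : Y s - Y t = (X n s - X n t) - (X n s - Y s) + (X n t - Y t).
    by rewrite opprB [X n s - _ + _]addrC !subrKA.
  rewrite (le_trans (ler_normD _ _))// mulrDl addrA lerD ?YP//.
  by rewrite (le_trans (ler_normB _ _))// lerD ?YP// admX.
have TY t : 0 <= t -> T Y t = Y t.
  move=> t0; apply/eqP; rewrite -subr_eq0 -normr_le0.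
  apply: (@le_of_geometric_error _ _ _ (2 * (C * w t))) => n.
  have -> : T Y t - Y t = (X n.+1 t - Y t) - (X n.+1 t - T Y t).
    by rewrite opprB [RHS]addrC addrA subrK.
  rewrite add0r (le_trans (ler_normB _ _))//.
  have -> : 2 * (C * w t) / 2 ^+ n =
    2 * (C * w t) / 2 ^+ n.+1 + C / 2 ^+ n * w t.
    by rewrite exprS; field; rewrite gt_eqF.
  rewrite lerD ?YP//; apply: (contract _ _ _ (admX n) admY) => //; last by rewrite divr_ge0// ltW.
  move=> r r0; have := YP r r0 n; congr (_ <= _); ring.
have [TY0 dTY] := TP _ admY.
by exists (T Y); split => // t t0; rewrite TY//; exact: dTY.
Qed.

End Picard.

(** * Radial retraction onto a ball *)

Section Retraction.
Context {R : realType} {V : normedModType R}.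
Implicit Types (x y : V) (rho : R).

(** The factor min (1, rho / |x|), in a form that is defined and positive also
    for x = 0. *)
Definition shrink rho x : R := (Num.max 1 (`|x| / rho))^-1.

Definition retract rho x : V := shrink rho x *: x.

Lemma shrink_gt0 rho x : 0 < shrink rho x.
Proof. by rewrite invr_gt0 lt_max ltr01. Qed.

Lemma shrink_le1 rho x : shrink rho x <= 1.
Proof. by rewrite invf_le1 ?le_max ?lexx// lt_max ltr01. Qed.

Lemma shrink_norm_le rho x : 0 < rho -> shrink rho x * `|x| <= rho.
Proof.
move=> r0; rewrite mulrC ler_pdivrMr ?lt_max ?ltr01// -ler_pdivrMl//.
by rewrite mulrC le_max lexx orbT.
Qed.

Lemma retract_norm_le rho x : 0 < rho -> `|retract rho x| <= rho.
Proof.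
by move=> r0; rewrite normrZ gtr0_norm ?shrink_gt0// shrink_norm_le.
Qed.

Lemma retract_id rho x : 0 < rho -> `|x| <= rho -> retract rho x = x.
Proof.
move=> r0 xr; rewrite /retract /shrink max_l ?invr1 ?scale1r//.
by rewrite ler_pdivrMr// mul1r.
Qed.

(** With s, t the two factors, the difference is s (x - y) + (s - t) y, and
    |s - t| |y| <= s |x - y| since |s - t| <= s t |x - y| / rho and t |y| <= rho. *)
Lemma retract_lipschitz rho x y : 0 < rho ->
  `|retract rho x - retract rho y| <= 2 * `|x - y|.
Proof.
move=> r0; set s := shrink rho x; set t := shrink rho y.
have -> : retract rho x - retract rho y = s *: (x - y) + (s - t) *: y.
  by rewrite scalerBr scalerBl addrA subrK.
rewrite (le_trans (ler_normD _ _))// (_ : 2 * _ = `|x - y| + `|x - y|); last first.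
  by rewrite mulr_natl mulr2n.
have s0 : 0 < s by exact: shrink_gt0.
have t0 : 0 < t by exact: shrink_gt0.
have s1 : s <= 1 by exact: shrink_le1.
rewrite lerD// normrZ; first by rewrite gtr0_norm// ler_piMl.
have -> : s - t = s * t * (Num.max 1 (`|y| / rho) - Num.max 1 (`|x| / rho)).
  rewrite -[Num.max 1 (`|y| / rho)]invrK -[Num.max 1 (`|x| / rho)]invrK.
  by rewrite -/(shrink _ _) -/(shrink _ _) -/s -/t; field; rewrite !gt_eqF.
rewrite !normrM (gtr0_norm s0) (gtr0_norm t0).
have MP : `|Num.max 1 (`|y| / rho) - Num.max 1 (`|x| / rho)| <= `|x - y| / rho.
  apply: (@le_trans _ _ `| `|x| / rho - `|y| / rho |).
    set a := `|x| / rho; set b := `|y| / rho.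
    rewrite !maxEle [leRHS]distrC; case: (leP 1 b) => h1; case: (leP 1 a) => h2;
      case: (ger0P (b - a)) => h3; rewrite ?ler_norml; lra.
  rewrite -mulrBl normrM [`|rho^-1|]gtr0_norm ?invr_gt0// ler_pM2r ?invr_gt0//.
  exact: ler_dist_dist.
set M := `|_ - _| in MP *; rewrite (_ : s * t * M * `|y| = s * (M * (t * `|y|))); last by ring.
apply: (@le_trans _ _ (1 * (`|x - y| / rho * rho))).
  have ty0 : 0 <= t * `|y| by rewrite mulr_ge0// ltW.
  apply: ler_pM; [exact: ltW|by rewrite mulr_ge0 ?normr_ge0|exact: s1|].
  by apply: ler_pM; [exact: normr_ge0|exact: ty0|exact: MP|exact: shrink_norm_le].
by rewrite mul1r divfK// gt_eqF.
Qed.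

End Retraction.

(** * Lyapunov's method *)

Section LyapunovTheory.
Context {R : realType} {V : normedModType R} {I : finType} {c : I -> V -> R}.
Hypothesis cV : sup_coordinates c.

(** dH x v stands for the differential of H at x applied to v.  Only the chain rule
    along curves matters below, and it is closed under sums and products of
    coordinates. *)
Definition has_derivation (H : V -> R) (dH : V -> V -> R) : Prop :=
  continuous H /\
  forall (X : R -> V) (t : R) v,
    is_derive t 1 X v -> is_derive t 1 (H \o X) (dH (X t) v).

Definition lipschitz_on_balls (W : normedModType R) (f : V -> W) : Prop :=
  forall r : R, exists K : R, forall x y : V,
    `|x| <= r -> `|y| <= r -> `|f x - f y| <= K * `|x - y|.

Variables (f : V -> V) (p : V).

Lemma is_derive_error (X : R -> V) (t : R) v :
  is_derive t 1 X v -> is_derive t 1 (fun s => X s - p) v.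
Proof.
move=> dX; rewrite -[v]subr0.
have -> : (fun s => X s - p) = X - cst p by [].
exact: is_deriveB.
Qed.

(** Gronwall's inequality in differential form.  The case k = 0 gives monotonicity
    of an energy, the case k > 0 exponential decay. *)
Lemma nonincreasing_along (H : V -> R) (dH : V -> V -> R) (X : R -> V)
    (k : R) (s t : R) :
  has_derivation H dH -> solution f X ->
  (forall r : R, 0 < r -> dH (X r - p) (f (X r)) <= - k * H (X r - p)) ->
  0 <= s -> s <= t ->
  expR (k * t) * H (X t - p) <= expR (k * s) * H (X s - p).
Proof.
move=> [cH HdH] [cX dX] Hk s0 st.
(* The factor 1 gives y the form treated by is_derive_scale_expR. *)
pose y (r : R) := 1 * expR (k * r) * H (X r - p).
suff : y t <= y s by rewrite /y !mul1r.
pose y' (r : R) := 1 * expR (k * r) * dH (X r - p) (f (X r)) +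
  H (X r - p) * (1 * (k * expR (k * r))).
apply: (@nonincreasing_of_derive _ y y') => // [x|r r0|r r0].
- have -> : y = (fun r : R => 1 * expR (k * r)) * (fun r => H (X r - p)) by [].
  apply: continuousM.
    have ce : continuous (fun r : R => 1 * expR (k * r)).
      move=> r; apply/differentiable_continuous/derivable1_diffP.
      by have [] := is_derive_scale_expR 1 k r.
    exact: (continuous_subspaceT ce).
  apply: continuous_comp; last exact: cH.
  by apply: continuousB; [exact: cX|exact: cst_continuous].
- have d1 := is_derive_scale_expR 1 k r.
  have d2 := HdH _ _ _ (is_derive_error (dX r r0)).
  exact: (is_deriveM d1 d2).
- rewrite /y'; have := Hk r r0; have := expR_gt0 (k * r).
  set e := expR _; set a := dH _ _; set h := H _ => e0 ah.
  have : e * a <= e * (- k * h) by rewrite ler_pM2l.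
  lra.
Qed.

Variables (H : V -> R) (dH : V -> V -> R) (a b : R).
Hypotheses (HdH : has_derivation H dH)
  (dHZ : forall (l : R) e v, dH (l *: e) v = l * dH e v)
  (a0 : 0 < a) (b0 : 0 < b)
  (aH : forall e, a * `|e| ^+ 2 <= H e) (Hb : forall e, H e <= b * `|e| ^+ 2)
  (dissipative : forall e, dH e (f (p + e)) <= 0).

Lemma energy_nonincreasing (X : R -> V) (t : R) :
  solution f X -> 0 <= t -> H (X t - p) <= H (X 0 - p).
Proof.
move=> solX t0.
have := @nonincreasing_along H dH X 0 0 t HdH solX _ (lexx 0) t0.
rewrite !mul0r expR0 !mul1r; apply => r _.
by rewrite oppr0 mul0r; have := dissipative (X r - p); rewrite subrKC.
Qed.

(** The retracted field e |-> f (p + retract rho e) has a global solution.  As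
    dH (l e) = l dH e, the sign of dH e (f (p + l e)) is that of
    dH (l e) (f (p + l e)), hence H decreases also along this solution, which
    never leaves the ball where the retraction is the identity. *)
Lemma forward_complete_of_dissipative :
  lipschitz_on_balls f -> forward_complete f.
Proof.
move=> fL x0; pose h := H (x0 - p).
(* Either |e| <= 1 or |e| <= |e|^2 <= H e / a. *)
pose rho := 1 + h / a.
have h0 : 0 <= h by apply: le_trans (aH _); rewrite mulr_ge0// ltW.
have rho1 : 1 <= rho by rewrite lerDl divr_ge0// ltW.
have rho0 : 0 < rho by exact: lt_le_trans rho1.
have sublevel e : H e <= h -> `|e| <= rho.
  move=> eh; have [|e1] := leP `|e| 1; first by move/le_trans; apply.
  rewrite (@le_trans _ _ (`|e| ^+ 2))//.
    by rewrite expr2 ler_peMl// ltW.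
  apply: (@le_trans _ _ (h / a)); last by rewrite lerDr.
  by rewrite ler_pdivlMr// mulrC (le_trans (aH e)).
have [K0 K0P] := fL (`|p| + rho); pose K := `|K0| + 1.
have K_gt0 : 0 < K by rewrite ltr_wpDl.
pose g e := f (p + retract rho e).
have in_ball e : `|p + retract rho e| <= `|p| + rho.
  by rewrite (le_trans (ler_normD _ _))// lerD2l retract_norm_le.
have fK x y : `|x| <= `|p| + rho -> `|y| <= `|p| + rho ->
    `|f x - f y| <= K * `|x - y|.
  move=> xr yr; rewrite (le_trans (K0P _ _ xr yr))// ler_wpM2r//.
  by rewrite (le_trans (ler_norm _))// lerDl.
have gK x y : `|g x - g y| <= K * 2 * `|x - y|.
  rewrite (le_trans (fK _ _ (in_ball x) (in_ball y)))// -mulrA ler_pM2l//.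
  by rewrite opprD addrACA subrr add0r retract_lipschitz.
have gB x : `|g x| <= `|f p| + K * rho.
  have pb : `|p| <= `|p| + rho by rewrite lerDl ltW.
  have := fK _ _ (in_ball x) pb; rewrite [p + _]addrC addrK => gp.
  rewrite -[g x](subrK (f p)) addrC (le_trans (ler_normD _ _))// lerD2l.
  by rewrite /g [p + _]addrC (le_trans gp)// ler_pM2l// retract_norm_le.
have K2 : 0 < K * 2 by rewrite mulr_gt0.
have [E [E0 dE]] := picard_lindelof_bounded cV (x0 - p) K2 gB gK.
have HE (t : R) : 0 <= t -> H (E t) <= h.
  move=> t0; rewrite /h -E0.
  have d (r : R) : 0 <= r -> is_derive r 1 (H \o E) (dH (E r) (g (E r))).
    by move=> r0; apply: HdH.2; exact: dE.
  apply: (@nonincreasing_of_derive _ _ (fun r => dH (E r) (g (E r)))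
    (derive_within_continuous d) _ _ _ _ (lexx 0) t0).
    by move=> r /ltW/d.
  move=> r _; have := dissipative (retract rho (E r)).
  by rewrite {1}/retract dHZ pmulr_rle0//; exact: shrink_gt0.
have dX (t : R) : 0 <= t -> is_derive t 1 (fun s : R => E s + p) (f (E t + p)).
  move=> t0; have := dE t t0.
  rewrite /g retract_id ?sublevel ?HE// addrC => dEt.
  rewrite -[X in is_derive _ _ _ X]addr0.
  have -> : (fun s : R => E s + p) = E + cst p by [].
  exact: is_deriveD.
exists (fun s : R => E s + p); split; last by rewrite E0 subrK.
by split=> [|t /ltW/dX]; [exact: derive_within_continuous dX|].
Qed.

Lemma lyapunov_stable_of_dissipative : lyapunov_stable f p.
Proof.
move=> e e0; pose d := e * Num.sqrt (a / b).
have ab0 : 0 < a / b by rewrite divr_gt0.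
have d0 : 0 < d by rewrite mulr_gt0// sqrtr_gt0.
have d2 : b * d ^+ 2 = a * e ^+ 2.
  by rewrite exprMn sqr_sqrtr ?ltW//; field; rewrite gt_eqF.
exists d => // X solX Xd t t0.
rewrite -(@ltr_pXn2r _ 2) ?nnegrE ?(ltW e0)//.
rewrite -(ltr_pM2l a0) -d2 (le_lt_trans (aH _))//.
rewrite (le_lt_trans (energy_nonincreasing solX t0))//.
rewrite (le_lt_trans (Hb _))// ltr_pM2l// ltr_pXn2r ?nnegrE ?(ltW d0)//.
Qed.

(** The strict Lyapunov function W may depend on the energy level h: a trajectory
    never leaves the sublevel set in which it starts. *)
Lemma globally_attractive_of_strict :
  (forall h : R, exists W : V -> R, exists dW : V -> V -> R,
    exists2 k : R, 0 < k &
    exists2 l : R, 0 < l &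
    [/\ has_derivation W dW, forall e, l * `|e| ^+ 2 <= W e &
      forall e, H e <= h -> dW e (f (p + e)) <= - k * W e]) ->
  globally_attractive f p.
Proof.
move=> strict X solX.
have [W [dW [k k0 [l l0 [WdW lW Wk]]]]] := strict (H (X 0 - p)).
have decay t : 0 <= t -> expR (k * t) * W (X t - p) <= W (X 0 - p).
  move=> t0.
  have := @nonincreasing_along W dW X k 0 t WdW solX _ (lexx 0) t0.
  rewrite mulr0 expR0 mul1r; apply => r r0.
  have := Wk (X r - p); rewrite subrKC; apply.
  by apply: energy_nonincreasing => //; exact: ltW.
apply/cvgrPdist_le => e e0; near=> t.
have t0 : 0 <= t by [].
rewrite distrC -(@ler_pXn2r _ 2) ?nnegrE ?(ltW e0)//.
have le0 : 0 < l * e ^+ 2 by rewrite mulr_gt0// exprn_gt0.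
have tW : W (X 0 - p) <= (l * e ^+ 2) * (k * t).
  by rewrite mulrA -ler_pdivrMl ?mulr_gt0//.
rewrite -(ler_pM2l l0) (le_trans (lW _))//.
rewrite -(ler_pM2l (expR_gt0 (k * t))) (le_trans (decay t t0))//.
rewrite (le_trans tW)// mulrC ler_pM2r// (le_trans _ (expR_ge1Dx _))//.
by rewrite lerDr.
Unshelve. all: by end_near. Qed.

End LyapunovTheory.

(** * Coordinate systems and polynomial maps *)

Section CoordinateSystems.
Context {R : realType}.

Lemma sup_coordinates_real :
  sup_coordinates (fun (_ : unit) (x : R) => x).
Proof.
split=> [//|x r r0|y]; last by exists (y tt); case.
by split=> [//|]; apply; exact: tt.
Qed.

Lemma sup_coordinates_col (n : nat) :
  sup_coordinates (fun (i : 'I_n) (x : 'cV[R]_n) => x i 0).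
Proof.
split=> [i a x y|x r r0|y].
- by rewrite !mxE.
- rewrite {1}/Num.Def.normr/= mx_normrE; split=> [/bigmax_leP[_ xr] i|xr].
    exact: (xr (i, 0)).
  by apply/bigmax_leP; split=> // -[i j] _ /=; rewrite (ord1 j).
- by exists (\col_i y i) => i; rewrite mxE.
Qed.

Lemma sup_coordinates_pair (V W : normedModType R) (I J : finType)
    (c : I -> V -> R) (d : J -> W -> R) :
  sup_coordinates c -> sup_coordinates d ->
  sup_coordinates (fun (k : I + J) (x : V * W) =>
    match k with inl i => c i x.1 | inr j => d j x.2 end).
Proof.
move=> cV dW; split=> [[i|j] a x y|x r r0|y].
- exact: (coord_linear cV).
- exact: (coord_linear dW).
- rewrite prod_normE/= ge_max; split=> [/andP[x1 x2] [i|j]|xr].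
  + exact: (coord_norm_le cV _ r0).1.
  + exact: (coord_norm_le dW _ r0).1.
  + apply/andP; split.
      by apply/(coord_norm_le cV) => // i; exact: xr (inl i).
    by apply/(coord_norm_le dW) => // j; exact: xr (inr j).
- have [v vP] := coord_surj cV (fun i => y (inl i)).
  have [w wP] := coord_surj dW (fun j => y (inr j)).
  by exists (v, w) => -[].
Qed.

End CoordinateSystems.

Section PolynomialMaps.
Context {R : realType} {V : normedModType R} {I : finType} {c : I -> V -> R}.
Hypothesis cV : sup_coordinates c.

Lemma lipschitz_on_balls_cst (a : R) :
  lipschitz_on_balls (fun _ : V => a).
Proof. by move=> r; exists 0 => x y _ _; rewrite subrr normr0 mul0r. Qed.

Lemma lipschitz_on_balls_coord i : lipschitz_on_balls (c i).
Proof.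
move=> r; exists 1 => x y _ _.
by rewrite mul1r -(coordB cV) (le_coord_norm cV).
Qed.

Lemma lipschitz_on_ballsD (f g : V -> R) :
  lipschitz_on_balls f -> lipschitz_on_balls g ->
  lipschitz_on_balls (fun x => f x + g x).
Proof.
move=> fL gL r; have [K KP] := fL r; have [L LP] := gL r.
exists (K + L) => x y xr yr; rewrite opprD addrACA mulrDl.
by rewrite (le_trans (ler_normD _ _))// lerD ?KP ?LP.
Qed.

Lemma lipschitz_on_ballsM (f g : V -> R) :
  lipschitz_on_balls f -> lipschitz_on_balls g ->
  lipschitz_on_balls (fun x => f x * g x).
Proof.
have bounded (h : V -> R) : lipschitz_on_balls h -> forall r,
    exists2 B, 0 <= B & forall x, `|x| <= r -> `|h x| <= B.
  move=> hL r; have [K KP] := hL r.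
  have [r0|r0] := ltP r 0.
    by exists 0 => // x; rewrite leNgt (lt_le_trans r0).
  exists (`|h 0| + `|K| * r); first by rewrite addr_ge0// mulr_ge0.
  move=> x xr; have := KP x 0 xr; rewrite normr0 => /(_ r0); rewrite subr0 => hx.
  rewrite -[h x](subrK (h 0)) addrC (le_trans (ler_normD _ _))// lerD2l.
  rewrite (le_trans hx)// (@le_trans _ _ (`|K| * `|x|))//.
    by rewrite ler_wpM2r// ler_norm.
  by rewrite ler_wpM2l.
move=> fL gL r.
have [A A0 fA] := bounded f fL r; have [B B0 gB] := bounded g gL r.
have [K KP] := fL r; have [L LP] := gL r.
exists (A * L + K * B) => x y xr yr.
have -> : f x * g x - f y * g y = f x * (g x - g y) + (f x - f y) * g y by ring.
rewrite (le_trans (ler_normD _ _))// !normrM mulrDl lerD//.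
  by rewrite -mulrA ler_pM ?fA ?LP.
by rewrite mulrAC ler_pM ?gB ?KP.
Qed.

Lemma lipschitz_on_balls_coordP (f : V -> V) :
  (forall i, lipschitz_on_balls (fun x => c i (f x))) -> lipschitz_on_balls f.
Proof.
move=> fL r; have /choice[K KP] := fun i => fL i r.
exists (\sum_i `|K i|) => x y xr yr; apply/(coord_norm_le cV) => [|i].
  by rewrite mulr_ge0// sumr_ge0.
rewrite (coordB cV) (le_trans (KP i x y xr yr))// ler_wpM2r//.
by rewrite (bigD1 i)//= (le_trans (ler_norm _))// lerDl sumr_ge0.
Qed.

Lemma has_derivation_coordM i j :
  has_derivation (fun x => c i x * c j x)
    (fun x v => c i x * c j v + c j x * c i v).
Proof.
split=> [x|X t v /(is_derive_coordP cV) dX].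
  by apply: continuousM; exact: (coord_continuous cV).
exact: (is_deriveM (dX i) (dX j)).
Qed.

Lemma has_derivationD (H G : V -> R) (dH dG : V -> V -> R) :
  has_derivation H dH -> has_derivation G dG ->
  has_derivation (fun x => H x + G x) (fun x v => dH x v + dG x v).
Proof.
move=> [cH HdH] [cG GdG]; split=> [x|X t v dX].
  by apply: continuousD; [exact: cH|exact: cG].
exact: (is_deriveD (HdH _ _ _ dX) (GdG _ _ _ dX)).
Qed.

Lemma has_derivationZ (a : R) (H : V -> R) (dH : V -> V -> R) :
  has_derivation H dH ->
  has_derivation (fun x => a * H x) (fun x v => a * dH x v).
Proof.
move=> [cH HdH]; split=> [x|X t v dX].
  by apply: continuousM; [exact: cst_continuous|exact: cH].
exact: (@is_deriveZ _ _ _ _ a _ _ _ (HdH _ _ _ dX)).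
Qed.

End PolynomialMaps.

(** * The closed loop in coordinates *)

Section StateSpace.
Context {R : realType}.
Local Notation state := (@Defs.state R).

Definition state_index : finType := (unit + unit + 'I_2 + 'I_2)%type.

Definition state_coord (k : state_index) (x : state) : R :=
  match k with
  | inl (inl (inl _)) => x.1.1.1
  | inl (inl (inr _)) => x.1.1.2
  | inl (inr i) => x.1.2 i 0
  | inr i => x.2 i 0
  end.

Lemma state_coordinates : sup_coordinates state_coord.
Proof.
exact: (sup_coordinates_pair (sup_coordinates_pair
  (sup_coordinates_pair sup_coordinates_real sup_coordinates_real)
  (@sup_coordinates_col R 2)) (@sup_coordinates_col R 2)).
Qed.

Definition xi_ix : state_index := inl (inl (inl tt)).
Definition vdc_ix : state_index := inl (inl (inr tt)).
Definition i_ix (k : 'I_2) : state_index := inl (inr k).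
Definition v_ix (k : 'I_2) : state_index := inr k.

Lemma ord2_cases (P : 'I_2 -> Prop) : P 0 -> P 1 -> forall k, P k.
Proof.
move=> P0 P1 [[|[|//]] k2].
  by rewrite (_ : Ordinal k2 = 0); last exact: val_inj.
by rewrite (_ : Ordinal k2 = 1); last exact: val_inj.
Qed.

Definition sqnorm (e : state) : R :=
  e.1.1.1 ^+ 2 + e.1.1.2 ^+ 2 + (e.1.2 0 0 ^+ 2 + e.1.2 1 0 ^+ 2)
  + (e.2 0 0 ^+ 2 + e.2 1 0 ^+ 2).

Lemma norm_le_sqnorm (e : state) : `|e| ^+ 2 <= sqnorm e.
Proof.
have s0 : 0 <= sqnorm e by rewrite /sqnorm !addr_ge0 ?sqr_ge0.
have le_s k : state_coord k e ^+ 2 <= sqnorm e.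
  rewrite /sqnorm.
  have := sqr_ge0 e.1.1.1; have := sqr_ge0 e.1.1.2.
  have := sqr_ge0 (e.1.2 0 0); have := sqr_ge0 (e.1.2 1 0).
  have := sqr_ge0 (e.2 0 0); have := sqr_ge0 (e.2 1 0).
  case: k => [[[[]|[]]|k]|k] /=; last 2 first.
  - by elim/ord2_cases: k; lra.
  - by elim/ord2_cases: k; lra.
  - lra.
  - lra.
suff : `|e| <= Num.sqrt (sqnorm e).
  by rewrite -(@ler_pXn2r _ 2) ?nnegrE ?sqrtr_ge0// sqr_sqrtr.
apply/(coord_norm_le state_coordinates); first exact: sqrtr_ge0.
move=> k; rewrite -(@ler_pXn2r _ 2) ?nnegrE ?sqrtr_ge0// sqr_sqrtr//.
by rewrite real_normK ?num_real.
Qed.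

Lemma sqnorm_le_norm (e : state) : sqnorm e <= 6 * `|e| ^+ 2.
Proof.
have le_e k : state_coord k e ^+ 2 <= `|e| ^+ 2.
  rewrite -[leLHS]real_normK ?num_real// ler_pXn2r ?nnegrE//.
  exact: (le_coord_norm state_coordinates).
have := le_e xi_ix; have := le_e vdc_ix.
have := le_e (i_ix 0); have := le_e (i_ix 1).
have := le_e (v_ix 0); have := le_e (v_ix 1).
rewrite /sqnorm /=; lra.
Qed.

End StateSpace.

Section ClosedLoopCoordinates.
Context {R : realType} (m : inverter R) (s : 'cV[R]_2) (dv : R).
Local Notation state := (@Defs.state R).
Implicit Types (x e v p : state).

Lemma dotE (u w : 'cV[R]_2) : dot u w = u 0 0 * w 0 0 + u 1 0 * w 1 0.
Proof.
rewrite /dot mxE big_ord_recl big_ord1 !mxE.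
by congr (_ * _ + _ * _); congr (_ _ _); apply: val_inj.
Qed.

Lemma dot_e2 (w : 'cV[R]_2) : dot e2 w = w 1 0.
Proof. by rewrite dotE /e2 !mxE /= mul0r mul1r add0r. Qed.

Lemma J_mulE0 (w : 'cV[R]_2) : (J *m w) 0 0 = - w 1 0.
Proof.
rewrite mxE big_ord_recl big_ord1 /J !mxE /=.
rewrite (_ : lift ord0 ord0 = 1); last exact: val_inj.
by rewrite /=; ring.
Qed.

Lemma J_mulE1 (w : 'cV[R]_2) : (J *m w) 1 0 = w 0 0.
Proof.
rewrite mxE big_ord_recl big_ord1 /J !mxE /=.
rewrite (_ : lift ord0 ord0 = 1); last exact: val_inj.
by rewrite /=; ring.
Qed.

Lemma impedance_mulE0 (a b : R) (w : 'cV[R]_2) :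
  ((a%:M + b *: J) *m w) 0 0 = a * w 0 0 - b * w 1 0.
Proof.
by rewrite mulmxDl mul_scalar_mx -scalemxAl mxE [in X in _ + X]mxE J_mulE0 mxE mulrN.
Qed.

Lemma impedance_mulE1 (a b : R) (w : 'cV[R]_2) :
  ((a%:M + b *: J) *m w) 1 0 = a * w 1 0 + b * w 0 0.
Proof.
by rewrite mulmxDl mul_scalar_mx -scalemxAl mxE [in X in _ + X]mxE J_mulE1 mxE.
Qed.

Definition mu x : R := droop m dv s x.2.

Lemma closed_loop_xi x : (closed_loop m s dv x).1.1.1 = x.1.1.2 - v_dc_ref m.
Proof. by case: x => [[[a b] i] v]. Qed.

Lemma closed_loop_vdc x : (closed_loop m s dv x).1.1.2 =
  (C_dc m + K_d m)^-1 *
     (- G_dc m * x.1.1.2 + i_dc_ref m - K_p m * (x.1.1.2 - v_dc_ref m)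
      - K_i m * x.1.1.1 - mu x / 2 * x.1.2 1 0).
Proof. by case: x => [[[a b] i] v]; rewrite /= dot_e2. Qed.

Lemma closed_loop_i0 x : (closed_loop m s dv x).1.2 0 0 =
  (Lf m)^-1 * (- (Rf m * x.1.2 0 0 - x.1.1.2 * eta m * Lf m * x.1.2 1 0)
               - x.2 0 0).
Proof.
case: x => [[[a b] i] v] /=.
have := impedance_mulE0 (Rf m) (b * eta m * Lf m) i.
by move: (_ *m i) => M ME; rewrite !mxE ME /mu /=; ring.
Qed.

Lemma closed_loop_i1 x : (closed_loop m s dv x).1.2 1 0 =
  (Lf m)^-1 * (- (Rf m * x.1.2 1 0 + x.1.1.2 * eta m * Lf m * x.1.2 0 0)
               + mu x / 2 * x.1.1.2 - x.2 1 0).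
Proof.
case: x => [[[a b] i] v] /=.
have := impedance_mulE1 (Rf m) (b * eta m * Lf m) i.
by move: (_ *m i) => M ME; rewrite !mxE ME /mu /=; ring.
Qed.

Lemma closed_loop_v0 x : (closed_loop m s dv x).2 0 0 =
  (Cf m)^-1 * (- (Gf m * x.2 0 0 - x.1.1.2 * eta m * Cf m * x.2 1 0)
               - s 0 0 + x.1.2 0 0).
Proof.
case: x => [[[a b] i] v] /=.
have := impedance_mulE0 (Gf m) (b * eta m * Cf m) v.
by move: (_ *m v) => M ME; rewrite !mxE ME /mu /=; ring.
Qed.

Lemma closed_loop_v1 x : (closed_loop m s dv x).2 1 0 =
  (Cf m)^-1 * (- (Gf m * x.2 1 0 + x.1.1.2 * eta m * Cf m * x.2 0 0)
               - s 1 0 + x.1.2 1 0).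
Proof.
case: x => [[[a b] i] v] /=.
have := impedance_mulE1 (Gf m) (b * eta m * Cf m) v.
by move: (_ *m v) => M ME; rewrite !mxE ME /mu /=; ring.
Qed.

End ClosedLoopCoordinates.

(** * The energy and its rate of change *)

Section RealInequalities.
Context {R : realType}.
Implicit Types (a b c d q k u w : R).

(** The difference of the two sides is q (a - t I1)^2 + q (b + t I0)^2 for t = u k / (2 q). *)
Lemma young_rotation q k u a b (I0 I1 : R) : 0 < q ->
  u * k * (a * I1 - b * I0) <=
    q * (a ^+ 2 + b ^+ 2) + u ^+ 2 * (k ^+ 2 * (I0 ^+ 2 + I1 ^+ 2) / (4 * q)).
Proof.
move=> q0; rewrite -subr_ge0.
set t := u * k / (2 * q).
have -> : q * (a ^+ 2 + b ^+ 2) + u ^+ 2 * (k ^+ 2 * (I0 ^+ 2 + I1 ^+ 2) / (4 * q))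
    - u * k * (a * I1 - b * I0)
  = q * ((a - t * I1) ^+ 2 + (b + t * I0) ^+ 2).
  by rewrite /t; field; rewrite gt_eqF.
by apply: mulr_ge0; [exact: ltW|rewrite addr_ge0 ?sqr_ge0].
Qed.

Lemma droop_cross_bound (s0 s1 S M I1 w b c d u : R) :
  `|s0| <= S -> `|s1| <= S -> `|I1| <= M -> `|w| <= M ->
  (s0 * c + s1 * d) * (w * b - I1 * u) / 2 <=
    S * M * (u ^+ 2 + b ^+ 2 + (c ^+ 2 + d ^+ 2)).
Proof.
move=> s0S s1S IM wM.
have S0 : 0 <= S by exact: le_trans s0S.
have M0 : 0 <= M by exact: le_trans IM.
have lin (x y z t B : R) : `|x| <= B -> `|y| <= B ->
    `|x * z + y * t| <= B * (`|z| + `|t|).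
  by move=> xB yB; rewrite (le_trans (ler_normD _ _))// !normrM mulrDr lerD// ler_wpM2r.
have h1 := lin s0 s1 c d S s0S s1S.
have h2 := lin w (- I1) b u M wM.
rewrite normrN mulNr in h2; move/(_ IM): h2 => h2.
rewrite ler_pdivrMr// (le_trans (ler_norm _))// normrM.
rewrite (le_trans (ler_pM _ _ h1 h2))//.
have -> : S * (`|c| + `|d|) * (M * (`|b| + `|u|)) =
  S * M * ((`|c| + `|d|) * (`|b| + `|u|)) by ring.
rewrite -[leRHS]mulrA ler_wpM2l ?mulr_ge0//.
rewrite -(real_normK (num_real u)) -(real_normK (num_real b)).
rewrite -(real_normK (num_real c)) -(real_normK (num_real d)).
move: `|b| `|c| `|d| `|u| => b' c' d' u'.
have := sqr_ge0 (b' - c'); have := sqr_ge0 (b' - d').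
by have := sqr_ge0 (u' - c'); have := sqr_ge0 (u' - d'); nra.
Qed.

End RealInequalities.

Section Energy.
Context {R : realType} (m : inverter R) (s : 'cV[R]_2) (dv : R).
Local Notation state := (@Defs.state R).
Local Notation F := (closed_loop m s dv).
Implicit Types (x y e v p : state).

Lemma state_addE x y :
  ((x + y).1.1.1 = x.1.1.1 + y.1.1.1) * ((x + y).1.1.2 = x.1.1.2 + y.1.1.2) *
  (forall k, (x + y).1.2 k 0 = x.1.2 k 0 + y.1.2 k 0) *
  (forall k, (x + y).2 k 0 = x.2 k 0 + y.2 k 0).
Proof. by split; [split; [split|]|] => // k; rewrite mxE. Qed.

Definition droop_variation e : R := dv * (s 0 0 * e.2 0 0 + s 1 0 * e.2 1 0).

Lemma mu_add p e : mu m s dv (p + e) = mu m s dv p + droop_variation e.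
Proof.
by rewrite /mu /droop /load_power !dotE !state_addE /droop_variation; ring.
Qed.

Let Cd := C_dc m + K_d m.

Lemma closed_loop_lipschitz : lipschitz_on_balls F.
Proof.
have L k : lipschitz_on_balls (@state_coord R k) by exact: (lipschitz_on_balls_coord state_coordinates).
have L1 : lipschitz_on_balls (fun x : state => x.1.1.1) := L xi_ix.
have L2 : lipschitz_on_balls (fun x : state => x.1.1.2) := L vdc_ix.
have L3 k : lipschitz_on_balls (fun x : state => x.1.2 k 0) := L (i_ix k).
have L4 k : lipschitz_on_balls (fun x : state => x.2 k 0) := L (v_ix k).
have Ladd (f g : state -> R) := @lipschitz_on_ballsD _ _ f g.
have Lmul (f g : state -> R) := @lipschitz_on_ballsM _ _ f g.
have Lcst (a : R) : lipschitz_on_balls (fun _ : state => a).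
  exact: lipschitz_on_balls_cst.
have Lopp (f : state -> R) : lipschitz_on_balls f -> lipschitz_on_balls (fun x => - f x).
  move=> fL r; have [K KP] := fL r; exists K => x y xr yr.
  by rewrite -opprD normrN; exact: KP.
have Lmu : lipschitz_on_balls (mu m s dv).
  rewrite (_ : mu m s dv = fun x => mu_ref m + dv * (s 0 0 * x.2 0 0 + s 1 0 * x.2 1 0 + - P_ref m)).
    repeat first [exact: L4 | exact: Lcst | apply Ladd | apply Lmul].
  by apply/funext => x; rewrite /mu /droop /load_power dotE.
apply: (lipschitz_on_balls_coordP state_coordinates) => -[[[[]|[]]|k]|k] /=.
4: elim/ord2_cases: k.
3: elim/ord2_cases: k.
1: under eq_fun do rewrite closed_loop_xi.
2: under eq_fun do rewrite closed_loop_vdc.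
3: under eq_fun do rewrite closed_loop_i0.
4: under eq_fun do rewrite closed_loop_i1.
5: under eq_fun do rewrite closed_loop_v0.
6: under eq_fun do rewrite closed_loop_v1.
all: by repeat first [exact: L1 | exact: L2 | exact: L3 | exact: L4
  | exact: Lmu | exact: Lcst | apply Lopp | apply Ladd | apply Lmul].
Qed.

(** The polarization of the energy; energy_form e is the differential of the energy
    at e. *)
Definition energy_form x y : R :=
  K_i m * (x.1.1.1 * y.1.1.1) + Cd * (x.1.1.2 * y.1.1.2)
  + Lf m * (x.1.2 0 0 * y.1.2 0 0 + x.1.2 1 0 * y.1.2 1 0)
  + Cf m * (x.2 0 0 * y.2 0 0 + x.2 1 0 * y.2 1 0).

Definition energy e : R := energy_form e e / 2.

Lemma has_derivation_energy : has_derivation energy energy_form.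
Proof.
have M k := has_derivation_coordM (@state_coordinates R) k k.
have := has_derivationZ 2^-1 (has_derivationD (has_derivationD (has_derivationD
  (has_derivationZ (K_i m) (M xi_ix)) (has_derivationZ Cd (M vdc_ix)))
  (has_derivationZ (Lf m) (has_derivationD (M (i_ix 0)) (M (i_ix 1)))))
  (has_derivationZ (Cf m) (has_derivationD (M (v_ix 0)) (M (v_ix 1))))).
congr has_derivation; first by apply/funext => e; rewrite /energy mulrC.
by apply/funext => e; apply/funext => v; rewrite /energy_form /=; field.
Qed.

(** The terms of degree three cancel: the rotations are antisymmetric, and the
    power that the droop variation takes from the DC side, droop_variation * u * i_2 / 2,
    is returned to the AC side. *)
Lemma energy_rate p e : energy_form e (F (p + e)) =
  energy_form e (F p)
  - (G_dc m + K_p m) * e.1.1.2 ^+ 2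
  - Rf m * (e.1.2 0 0 ^+ 2 + e.1.2 1 0 ^+ 2)
  - Gf m * (e.2 0 0 ^+ 2 + e.2 1 0 ^+ 2)
  + e.1.1.2 * (eta m * Lf m) * (e.1.2 0 0 * p.1.2 1 0 - e.1.2 1 0 * p.1.2 0 0)
  + e.1.1.2 * (eta m * Cf m) * (e.2 0 0 * p.2 1 0 - e.2 1 0 * p.2 0 0)
  + droop_variation e * (p.1.1.2 * e.1.2 1 0 - p.1.2 1 0 * e.1.1.2) / 2.
Proof.
have Cd0 : Cd != 0 by rewrite gt_eqF// addr_gt0 ?C_dc_gt0 ?K_d_gt0.
have L0 : Lf m != 0 by rewrite gt_eqF// Lf_gt0.
have C0 : Cf m != 0 by rewrite gt_eqF// Cf_gt0.
rewrite /energy_form !closed_loop_xi !closed_loop_vdc !closed_loop_i0.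
rewrite !closed_loop_i1 !closed_loop_v0 !closed_loop_v1 mu_add !state_addE -/Cd.
by field; rewrite L0 C0 Cd0.
Qed.

End Energy.

(** * A dissipation rate uniform in the steady state *)

Section Dissipation.
Context {R : realType} (m : inverter R) (s : 'cV[R]_2).
Local Notation state := (@Defs.state R).

(** The part of the squared error on which the losses act. *)
Definition damped_sqnorm (e : state) : R :=
  e.1.1.2 ^+ 2 + (e.1.2 0 0 ^+ 2 + e.1.2 1 0 ^+ 2)
  + (e.2 0 0 ^+ 2 + e.2 1 0 ^+ 2).

Definition admissible_steady_state (p : state) : Prop :=
  (Cf m) ^+ 2 * enorm p.2 ^+ 2 / (4 * Gf m) +
    (Lf m) ^+ 2 * enorm p.1.2 ^+ 2 / (4 * Rf m) < G_dc m / eta m ^+ 2.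

Lemma enorm_sqr (w : 'cV[R]_2) : enorm w ^+ 2 = w 0 0 ^+ 2 + w 1 0 ^+ 2.
Proof.
by rewrite /enorm dotE -!expr2 sqr_sqrtr// addr_ge0 ?sqr_ge0.
Qed.

Lemma eta_gt0 : 0 < eta m.
Proof. by rewrite divr_gt0 ?omega0_gt0 ?v_dc_ref_gt0. Qed.

Lemma equilibrium_vdc dv (p : state) :
  equilibrium (closed_loop m s dv) p -> p.1.1.2 = v_dc_ref m.
Proof.
move=> /(congr1 (fun x : state => x.1.1.1)); rewrite closed_loop_xi /= => h.
by apply/eqP; rewrite -subr_eq0 h.
Qed.

Lemma energy_form0 (e : state) : energy_form m e 0 = 0.
Proof. by rewrite /energy_form /= !mxE; ring. Qed.

(** Young's inequality is applied with the fraction theta of the AC losses for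
    which G_dc / theta = G_dc + K_p / 2.  This leaves (K_p / 2) u^2 and the
    fraction 1 - theta of the AC losses, a margin fixed by the parameters, half
    of which is reserved for the droop terms. *)
Lemma uniform_dissipation : exists2 kappa : R, 0 < kappa &
  exists2 d : R, 0 < d & forall dv : R, 0 < dv -> dv < d ->
  forall p : state, equilibrium (closed_loop m s dv) p -> admissible_steady_state p ->
  forall e : state, energy_form m e (closed_loop m s dv (p + e)) <=
            - kappa * damped_sqnorm e.
Proof.
have [[[R0 G0] L0] C0] := (Rf_gt0 m, Gf_gt0 m, Lf_gt0 m, Cf_gt0 m).
have [[[D0 P0] w0] n0] := (G_dc_gt0 m, K_p_gt0 m, v_dc_ref_gt0 m, eta_gt0).
pose theta := G_dc m / (G_dc m + K_p m / 2).
have DP0 : 0 < G_dc m + K_p m / 2 by lra.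
have th0 : 0 < theta by rewrite divr_gt0.
have th1 : theta < 1 by rewrite ltr_pdivrMr//; lra.
have Dth : G_dc m / theta = G_dc m + K_p m / 2.
  by rewrite /theta; field; rewrite !gt_eqF//=; lra.
pose kappa := Num.min (K_p m / 2)
  (Num.min ((1 - theta) * Rf m) ((1 - theta) * Gf m)) / 2.
have k0 : 0 < kappa by rewrite divr_gt0// !lt_min !mulr_gt0 ?subr_gt0// invr_gt0.
have kP : 2 * kappa <= K_p m / 2.
  by rewrite mulrC divfK// ge_min lexx.
have kR : 2 * kappa <= (1 - theta) * Rf m.
  by rewrite mulrC divfK// !ge_min lexx orbT.
have kG : 2 * kappa <= (1 - theta) * Gf m.
  by rewrite mulrC divfK// !ge_min lexx !orbT.
clearbody kappa.
pose S := `|s 0 0| + `|s 1 0|.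
(* M0 bounds the square of the steady-state current, by the assumed inequality. *)
pose M0 := 4 * Rf m * G_dc m / (eta m * Lf m) ^+ 2.
have M00 : 0 <= M0 by rewrite divr_ge0 ?sqr_ge0// !mulr_ge0// ltW.
(* |y| <= 1 + y^2 turns the bound on the square into one on the current. *)
pose M := 1 + M0 + v_dc_ref m.
have SM0 : 0 <= S * M.
  by rewrite mulr_ge0 ?addr_ge0// ltW.
exists kappa => //; exists (kappa / (1 + S * M)).
  by rewrite divr_gt0// ltr_wpDr.
move=> dv dv0; rewrite ltr_pdivlMr ?ltr_wpDr// => dvd p pe adm e.
have dvSM : dv * (S * M) <= kappa by nra.
rewrite energy_rate (pe : closed_loop m s dv p = 0) energy_form0.
rewrite (equilibrium_vdc pe).
move: adm; rewrite /admissible_steady_state !enorm_sqr.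
rewrite ltr_pdivlMr ?exprn_gt0// => adm.
have I1M : `|p.1.2 1 0| <= M.
  have I2 : p.1.2 1 0 ^+ 2 <= M0.
    rewrite ler_pdivlMr; last by rewrite exprn_gt0// mulr_gt0 ?n0 ?L0.
    have V0 : 0 <= Cf m ^+ 2 * (p.2 0 0 ^+ 2 + p.2 1 0 ^+ 2) / (4 * Gf m).
      by rewrite divr_ge0 ?mulr_ge0 ?addr_ge0 ?sqr_ge0// ltW.
    have n2 : 0 < eta m ^+ 2 by rewrite exprn_gt0.
    have : Lf m ^+ 2 * (p.1.2 0 0 ^+ 2 + p.1.2 1 0 ^+ 2) / (4 * Rf m) * eta m ^+ 2 < G_dc m.
      by apply: le_lt_trans adm; rewrite ler_pM2r// lerDr.
    rewrite mulrAC ltr_pdivrMr ?mulr_gt0//.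
    set q := _ * eta m ^+ 2; move=> qD.
    have -> : p.1.2 1 0 ^+ 2 * (eta m * Lf m) ^+ 2 =
      q - (p.1.2 0 0 * Lf m * eta m) ^+ 2 by rewrite /q; ring.
    by have := sqr_ge0 (p.1.2 0 0 * Lf m * eta m); lra.
  rewrite -(real_normK (num_real (p.1.2 1 0))) in I2; rewrite /M.
  have := sqr_ge0 (`|p.1.2 1 0| - 1); rewrite sqrrB1 => h.
  by have := normr_ge0 (p.1.2 1 0); lra.
have wM : `|v_dc_ref m| <= M by rewrite gtr0_norm// /M; lra.
have s0S : `|s 0 0| <= S by rewrite lerDl.
have s1S : `|s 1 0| <= S by rewrite lerDr.
have y1 := young_rotation (eta m * Lf m) e.1.1.2 (e.1.2 0 0) (e.1.2 1 0)
  (p.1.2 0 0) (p.1.2 1 0) (mulr_gt0 th0 R0).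
have y2 := young_rotation (eta m * Cf m) e.1.1.2 (e.2 0 0) (e.2 1 0)
  (p.2 0 0) (p.2 1 0) (mulr_gt0 th0 G0).
have y3 := droop_cross_bound (e.1.2 1 0) (e.2 0 0) (e.2 1 0) (e.1.1.2)
  s0S s1S I1M wM.
(* The assumed inequality, multiplied by eta^2 / theta. *)
have X : (eta m * Lf m) ^+ 2 * (p.1.2 0 0 ^+ 2 + p.1.2 1 0 ^+ 2) / (4 * (theta * Rf m))
  + (eta m * Cf m) ^+ 2 * (p.2 0 0 ^+ 2 + p.2 1 0 ^+ 2) / (4 * (theta * Gf m))
  <= G_dc m + K_p m / 2.
  rewrite -Dth ler_pdivlMr//; apply: le_trans (ltW adm).
  by rewrite le_eqVlt; apply/orP; left; apply/eqP; field; rewrite !gt_eqF.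
have y4 : droop_variation s dv e * (v_dc_ref m * e.1.2 1 0 - p.1.2 1 0 * e.1.1.2) / 2
   <= kappa * (e.1.1.2 ^+ 2 + e.1.2 1 0 ^+ 2 + (e.2 0 0 ^+ 2 + e.2 1 0 ^+ 2)).
  move: y3; set Q := (X in _ <= _ * X); set T := (X in X <= _) => TQ.
  have Q0 : 0 <= Q by rewrite !addr_ge0 ?sqr_ge0.
  have -> : droop_variation s dv e *
      (v_dc_ref m * e.1.2 1 0 - p.1.2 1 0 * e.1.1.2) / 2 = dv * T.
    by rewrite /droop_variation /T; ring.
  apply: (@le_trans _ _ (dv * (S * M * Q))); first by rewrite ler_pM2l.
  by rewrite mulrA ler_wpM2r.
move: y1 y2 y4 X => {y3}.
rewrite /damped_sqnorm.
set XI := _ / (4 * (theta * Rf m)); set XV := _ / (4 * (theta * Gf m)).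
set A := _ * (eta m * Lf m) * _; set B := _ * (eta m * Cf m) * _.
set T := droop_variation _ _ _ * _ / 2.
move: (e.1.1.2 ^+ 2) (sqr_ge0 e.1.1.2) => u2 u20.
move: (e.1.2 0 0 ^+ 2) (sqr_ge0 (e.1.2 0 0)) => a2 a20.
move: (e.1.2 1 0 ^+ 2) (sqr_ge0 (e.1.2 1 0)) => b2 b20.
move: (e.2 0 0 ^+ 2) (sqr_ge0 (e.2 0 0)) => c2 c20.
move: (e.2 1 0 ^+ 2) (sqr_ge0 (e.2 1 0)) => d2 d20.
move: A B T XI XV => A B T XI XV y1 y2 y4 X.
have z1 : u2 * (XI + XV) <= u2 * (G_dc m + K_p m / 2) by rewrite ler_wpM2l.
have z2 : 2 * kappa * u2 <= K_p m / 2 * u2 by rewrite ler_wpM2r.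
have z3 : 2 * kappa * (a2 + b2) <= (1 - theta) * Rf m * (a2 + b2).
  by rewrite ler_wpM2r// addr_ge0.
have z4 : 2 * kappa * (c2 + d2) <= (1 - theta) * Gf m * (c2 + d2).
  by rewrite ler_wpM2r// addr_ge0.
have z5 : 0 <= kappa * a2 by rewrite mulr_ge0// ltW.
lra.
Qed.

End Dissipation.

(** * Exponential decay on sublevel sets *)

Lemma sqr_sum4_le (R : realType) (B a1 a2 a3 a4 x1 x2 x3 x4 : R) :
  a1 ^+ 2 <= B -> a2 ^+ 2 <= B -> a3 ^+ 2 <= B -> a4 ^+ 2 <= B ->
  (a1 * x1 + a2 * x2 + (a3 * x3 + a4 * x4)) ^+ 2 <=
    4 * B * (x1 ^+ 2 + x2 ^+ 2 + (x3 ^+ 2 + x4 ^+ 2)).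
Proof.
have sq a x : a ^+ 2 <= B -> (a * x) ^+ 2 <= B * x ^+ 2.
  by move=> aB; rewrite exprMn ler_wpM2r ?sqr_ge0.
move=> /(sq _ x1) + /(sq _ x2) + /(sq _ x3) + /(sq _ x4).
move: (a1 * x1) (a2 * x2) (a3 * x3) (a4 * x4) => y1 y2 y3 y4 h1 h2 h3 h4.
apply: (@le_trans _ _ (4 * (y1 ^+ 2 + y2 ^+ 2 + (y3 ^+ 2 + y4 ^+ 2)))).
  rewrite -subr_ge0.
  have -> : 4 * (y1 ^+ 2 + y2 ^+ 2 + (y3 ^+ 2 + y4 ^+ 2)) -
      (y1 + y2 + (y3 + y4)) ^+ 2 =
    (y1 - y2) ^+ 2 + (y1 - y3) ^+ 2 + (y1 - y4) ^+ 2 + (y2 - y3) ^+ 2 +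
    (y2 - y4) ^+ 2 + (y3 - y4) ^+ 2 by ring.
  by rewrite !addr_ge0 ?sqr_ge0.
by lra.
Qed.

Section StrictEnergy.
Context {R : realType} (m : inverter R) (s : 'cV[R]_2) (dv : R).
Local Notation state := (@Defs.state R).
Local Notation F := (closed_loop m s dv).
Implicit Types (e v p : state).

Let Cd := C_dc m + K_d m.

Definition coercivity : R :=
  Num.min (Num.min (K_i m) Cd) (Num.min (Lf m) (Cf m)) / 4.

Definition growth : R := K_i m + Cd + Lf m + Cf m.

Let params_gt0 : [/\ 0 < K_i m, 0 < Cd, 0 < Lf m & 0 < Cf m].
Proof.
by split; rewrite ?K_i_gt0 ?Lf_gt0 ?Cf_gt0// addr_gt0 ?C_dc_gt0 ?K_d_gt0.
Qed.

Lemma coercivity_gt0 : 0 < coercivity.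
Proof.
by have [? ? ? ?] := params_gt0; rewrite divr_gt0// !lt_min; do !(apply/andP; split).
Qed.

Lemma growth_gt0 : 0 < growth.
Proof.
by have [? ? ? ?] := params_gt0; do 3!apply: addr_gt0 => //.
Qed.

Definition strict_energy (eps : R) e : R :=
  energy m e + eps * Cd * (e.1.1.1 * e.1.1.2).

Definition strict_energy_form (eps : R) e v : R :=
  energy_form m e v + eps * Cd * (e.1.1.1 * v.1.1.2 + e.1.1.2 * v.1.1.1).

Lemma has_derivation_strict_energy eps :
  has_derivation (strict_energy eps) (strict_energy_form eps).
Proof.
apply: has_derivationD; first exact: has_derivation_energy.
apply: has_derivationZ.
exact: (has_derivation_coordM (@state_coordinates R) xi_ix vdc_ix).
Qed.

(** The correction eps (C_dc + K_d) x u is at most half of the x and u parts of the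
    energy, in absolute value. *)
Lemma strict_energy_bounds eps e : 0 <= eps -> eps <= 1 / 2 ->
  eps * Cd <= K_i m / 2 ->
  coercivity * sqnorm e <= strict_energy eps e <= growth * sqnorm e.
Proof.
move=> e0 e12 eK; have [Ki0 Cd0 L0 C0] := params_gt0.
have eC : eps * Cd <= Cd / 2 by nra.
have eC0 : 0 <= eps * Cd by rewrite mulr_ge0// ltW.
rewrite /strict_energy /energy /energy_form /sqnorm -/Cd -!expr2.
have : coercivity * 4 <= K_i m /\ coercivity * 4 <= Cd /\
       coercivity * 4 <= Lf m /\ coercivity * 4 <= Cf m.
  by rewrite /coercivity divfK// !ge_min !lexx !orbT.
move=> [l1 [l2 [l3 l4]]].
have := coercivity_gt0; rewrite /growth; move: coercivity l1 l2 l3 l4 => l l1 l2 l3 l4 l0.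
set x := e.1.1.1; set u := e.1.1.2.
have /andP[xu1 xu2] : - (x ^+ 2 + u ^+ 2) / 2 <= x * u <= (x ^+ 2 + u ^+ 2) / 2.
  have := sqr_ge0 (x - u); have := sqr_ge0 (x + u).
  by rewrite sqrrD sqrrB => ? ?; apply/andP; split; lra.
have c1 : eps * Cd * (- (x ^+ 2 + u ^+ 2) / 2) <= eps * Cd * (x * u).
  by rewrite ler_wpM2l.
have c2 : eps * Cd * (x * u) <= eps * Cd * ((x ^+ 2 + u ^+ 2) / 2).
  by rewrite ler_wpM2l.
move: (eps * Cd * (x * u)) c1 c2 => T c1 c2.
move: (x ^+ 2) (sqr_ge0 x) c1 c2 xu1 xu2 => x2 x20 c1 c2 _ _.
move: (u ^+ 2) (sqr_ge0 u) c1 c2 => u2 u20 c1 c2.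
have d1 : eps * Cd * x2 <= K_i m / 2 * x2 by rewrite ler_wpM2r.
have d2 : eps * Cd * u2 <= Cd / 2 * u2 by rewrite ler_wpM2r.
have sq w : 0 <= w ^+ 2 :> R by exact: sqr_ge0.
have i20 : 0 <= e.1.2 0 0 ^+ 2 + e.1.2 1 0 ^+ 2 by rewrite addr_ge0.
have v20 : 0 <= e.2 0 0 ^+ 2 + e.2 1 0 ^+ 2 by rewrite addr_ge0.
move: (_ + _) i20 (e.2 0 0 ^+ 2 + e.2 1 0 ^+ 2) v20 => i2 i20 v2 v20.
have f1 : l * 4 * x2 <= K_i m * x2 by rewrite ler_wpM2r.
have f2 : l * 4 * u2 <= Cd * u2 by rewrite ler_wpM2r.
have f3 : l * 4 * i2 <= Lf m * i2 by rewrite ler_wpM2r.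
have f4 : l * 4 * v2 <= Cf m * v2 by rewrite ler_wpM2r.
have lx : 0 <= l * x2 by rewrite mulr_ge0// ltW.
have lu : 0 <= l * u2 by rewrite mulr_ge0// ltW.
have li : 0 <= l * i2 by rewrite mulr_ge0// ltW.
have lv : 0 <= l * v2 by rewrite mulr_ge0// ltW.
have g a y : 0 < a -> 0 <= y -> 0 <= a * y :> R by move=> ? ?; rewrite mulr_ge0// ltW.
have [[Ku Ki] Kv] := (g _ _ Ki0 u20, g _ _ Ki0 i20, g _ _ Ki0 v20).
by apply/andP; split; [lra|nra].
Qed.

Lemma energy_bounds e :
  coercivity * `|e| ^+ 2 <= energy m e <= 6 * growth * `|e| ^+ 2.
Proof.
have := @strict_energy_bounds 0 e (lexx 0).
rewrite /strict_energy !mul0r addr0 => /(_ _ _)/andP[].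
- by lra.
- by rewrite divr_ge0// ltW// K_i_gt0.
move=> h1 h2; apply/andP; split.
  by rewrite (le_trans _ h1)// ler_pM2l ?coercivity_gt0// norm_le_sqnorm.
rewrite (le_trans h2)// [6 * _]mulrC -mulrA ler_pM2l ?growth_gt0//.
exact: sqnorm_le_norm.
Qed.

(** The term - K_i x in the DC-voltage equation is what makes the integrator error
    visible to the correction x u of the energy. *)
Lemma vdc_rate p e : equilibrium F p ->
  Cd * (F (p + e)).1.1.2 =
  - K_i m * e.1.1.1
  + (- (G_dc m + K_p m) * e.1.1.2 + - (mu m s dv p / 2) * e.1.2 1 0
     + (- (dv * s 0 0 / 2 * (p.1.2 1 0 + e.1.2 1 0)) * e.2 0 0
        + - (dv * s 1 0 / 2 * (p.1.2 1 0 + e.1.2 1 0)) * e.2 1 0)).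
Proof.
move=> pe; have [_ Cd0 _ _] := params_gt0.
have : Cd * (F p).1.1.2 = 0 by rewrite (pe : F p = 0) mulr0.
rewrite !closed_loop_vdc -/Cd mu_add !state_addE /droop_variation => Ep.
by rewrite -[LHS]subr0 -Ep; field; rewrite gt_eqF.
Qed.

(** Apart from - K_i x, the rate of u is a combination r of (u, i, v) whose
    coefficients are bounded on the sublevel set: the only quadratic contribution
    is the droop variation times i_2, and H bounds i_2.  Young's inequality
    bounds x r by K_i x^2 / 2 plus a multiple of the damped part, which the
    dissipation absorbs for small eps. *)
Lemma strict_decay p (kappa h : R) : 0 < kappa -> equilibrium F p ->
  (forall e, energy_form m e (F (p + e)) <= - kappa * damped_sqnorm e) ->
  exists eps : R, exists2 k : R, 0 < k &
    (forall e, coercivity * `|e| ^+ 2 <= strict_energy eps e) /\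
    (forall e, energy m e <= h ->
      strict_energy_form eps e (F (p + e)) <= - k * strict_energy eps e).
Proof.
move=> k0 pe diss; have [Ki0 Cd0 L0 C0] := params_gt0.
(* rho bounds the square of the second current component on the sublevel set. *)
pose rho := 2 * `|h| / Lf m.
pose B := (G_dc m + K_p m) ^+ 2 + (mu m s dv p / 2) ^+ 2
  + ((dv * s 0 0 / 2) ^+ 2 + (dv * s 1 0 / 2) ^+ 2)
    * (2 * (p.1.2 1 0 ^+ 2 + rho)).
have rho0 : 0 <= rho by rewrite divr_ge0 ?mulr_ge0// ltW.
have B0 : 0 <= B.
  by repeat first [exact: sqr_ge0 | exact: rho0 | apply: addr_ge0 | apply: mulr_ge0].
pose D := Cd + 2 * B / K_i m.
have D0 : 0 < D by rewrite ltr_wpDr// divr_ge0 ?mulr_ge0// ltW.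
pose eps := Num.min (kappa / (2 * D)) (Num.min (1 / 2) (K_i m / (2 * Cd))).
have eps0 : 0 < eps by rewrite !lt_min !divr_gt0 ?mulr_gt0.
have eps1 : eps * D <= kappa / 2.
  have : eps <= kappa / (2 * D) by rewrite ge_min lexx.
  by rewrite ler_pdivlMr ?mulr_gt0//; lra.
have eps2 : eps <= 1 / 2 by rewrite !ge_min lexx orbT.
have eps3 : eps * Cd <= K_i m / 2.
  have : eps <= K_i m / (2 * Cd) by rewrite !ge_min lexx !orbT.
  by rewrite ler_pdivlMr ?mulr_gt0//; lra.
clearbody eps.
have bounds e := strict_energy_bounds e (ltW eps0) eps2 eps3.
pose gamma := Num.min (kappa / 2) (eps * K_i m / 2).
have g0 : 0 < gamma by rewrite lt_min !divr_gt0 ?mulr_gt0.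
have gk : gamma <= kappa / 2 by rewrite ge_min lexx.
have ge : gamma <= eps * K_i m / 2 by rewrite ge_min lexx orbT.
clearbody gamma.
exists eps; exists (gamma / growth); first by rewrite divr_gt0 ?growth_gt0.
split=> [e|e eh].
  have /andP[+ _] := bounds e; apply: le_trans.
  by rewrite ler_pM2l ?coercivity_gt0// norm_le_sqnorm.
apply: (@le_trans _ _ (- gamma * sqnorm e)); last first.
  have /andP[_ We] := bounds e.
  by rewrite !mulNr lerN2 mulrAC ler_pdivrMr ?growth_gt0// -mulrA ler_pM2l// mulrC.
have rho_e : e.1.2 1 0 ^+ 2 <= rho.
  rewrite ler_pdivlMr//.
  have : energy m e <= `|h| by rewrite (le_trans eh)// ler_norm.
  rewrite /energy /energy_form -!expr2 -/Cd.
  have p1 := mulr_ge0 (ltW Ki0) (sqr_ge0 e.1.1.1).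
  have p2 := mulr_ge0 (ltW Cd0) (sqr_ge0 e.1.1.2).
  have p3 := mulr_ge0 (ltW L0) (sqr_ge0 (e.1.2 0 0)).
  have p4 := mulr_ge0 (ltW C0) (sqr_ge0 (e.2 0 0)).
  have p5 := mulr_ge0 (ltW C0) (sqr_ge0 (e.2 1 0)).
  by lra.
have Eu : (F (p + e)).1.1.1 = e.1.1.2.
  by rewrite closed_loop_xi state_addE (equilibrium_vdc pe) addrC addKr.
have := vdc_rate e pe; set r := (X in _ = _ + X) => Er.
have sq2 : (p.1.2 1 0 + e.1.2 1 0) ^+ 2 <= 2 * (p.1.2 1 0 ^+ 2 + rho).
  by have := sqr_ge0 (p.1.2 1 0 - e.1.2 1 0); rewrite sqrrB sqrrD; lra.
have r2 : r ^+ 2 <= 4 * B * damped_sqnorm e.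
  have t a : 0 <= (dv * a / 2) ^+ 2 * (2 * (p.1.2 1 0 ^+ 2 + rho)).
    by repeat first [exact: sqr_ge0 | exact: rho0 | apply: addr_ge0 | apply: mulr_ge0].
  have t' a : (- (dv * a / 2 * (p.1.2 1 0 + e.1.2 1 0))) ^+ 2 <=
      (dv * a / 2) ^+ 2 * (2 * (p.1.2 1 0 ^+ 2 + rho)).
    by rewrite sqrrN exprMn ler_wpM2l ?sqr_ge0.
  have := t (s 0 0); have := t (s 1 0).
  have := t' (s 0 0); have := t' (s 1 0).
  have := sqr_ge0 (G_dc m + K_p m); have := sqr_ge0 (mu m s dv p / 2).
  move=> q1 q2 q3 q4 q5 q6.
  rewrite /r; apply: le_trans.
    by apply: (sqr_sum4_le (B := B)); rewrite ?[(- (G_dc m + _)) ^+ 2]sqrrN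
      ?[(- (mu m s dv p / 2)) ^+ 2]sqrrN /B [X in _ <= _ + X]mulrDl; lra.
  apply: ler_wpM2l; first exact: mulr_ge0.
  by rewrite /damped_sqnorm; have := sqr_ge0 (e.1.2 0 0); lra.
have xr : e.1.1.1 * r <= K_i m / 2 * e.1.1.1 ^+ 2 + 2 * B / K_i m * damped_sqnorm e.
  have : r ^+ 2 / (2 * K_i m) <= 4 * B * damped_sqnorm e / (2 * K_i m).
    by rewrite ler_pM2r// invr_gt0 mulr_gt0.
  have -> : 4 * B * damped_sqnorm e / (2 * K_i m) = 2 * B / K_i m * damped_sqnorm e.
    by field; rewrite gt_eqF.
  have : 0 <= K_i m / 2 * (e.1.1.1 - r / K_i m) ^+ 2.
    by rewrite mulr_ge0 ?sqr_ge0// divr_ge0// ltW.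
  have -> : K_i m / 2 * (e.1.1.1 - r / K_i m) ^+ 2 =
    K_i m / 2 * e.1.1.1 ^+ 2 - e.1.1.1 * r + r ^+ 2 / (2 * K_i m).
    by field; rewrite gt_eqF.
  lra.
have uN : e.1.1.2 ^+ 2 <= damped_sqnorm e.
  by rewrite /damped_sqnorm -addrA lerDl !addr_ge0 ?sqr_ge0.
rewrite /strict_energy_form Eu.
have -> : eps * Cd * (e.1.1.1 * (F (p + e)).1.1.2 + e.1.1.2 * e.1.1.2) =
    eps * (- K_i m * e.1.1.1 ^+ 2 + e.1.1.1 * r + Cd * e.1.1.2 ^+ 2).
  rewrite -mulrA mulrDr [Cd * (e.1.1.1 * _)]mulrCA Er; ring.
have -> : sqnorm e = e.1.1.1 ^+ 2 + damped_sqnorm e.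
  by rewrite /sqnorm /damped_sqnorm; ring.
have := diss e.
have N0 : 0 <= damped_sqnorm e by exact: le_trans (sqr_ge0 _) uN.
move: (damped_sqnorm e) N0 uN xr r2 => N N0 uN xr _.
have step : eps * (- K_i m * e.1.1.1 ^+ 2 + e.1.1.1 * r + Cd * e.1.1.2 ^+ 2)
   <= eps * (- (K_i m / 2) * e.1.1.1 ^+ 2 + D * N).
  rewrite ler_pM2l// /D.
  have := ler_wpM2l (ltW Cd0) uN; lra.
have eD : eps * D * N <= kappa / 2 * N by rewrite ler_wpM2r.
have gN : gamma * N <= kappa / 2 * N by rewrite ler_wpM2r.
have gx : gamma * e.1.1.1 ^+ 2 <= eps * K_i m / 2 * e.1.1.1 ^+ 2.
  by rewrite ler_wpM2r ?sqr_ge0.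
lra.
Qed.

End StrictEnergy.

Theorem proposition10 (R : realType) (m : inverter R) (s : 'cV[R]_2) :
  exists2 d : R, 0 < d &
    forall dv : R, 0 < dv -> dv < d ->
    forall (xi_s vdc_s : R) (i_s v_s : 'cV[R]_2),
      equilibrium (closed_loop m s dv) (xi_s, vdc_s, i_s, v_s) ->
      (Cf m) ^+ 2 * enorm v_s ^+ 2 / (4 * Gf m) +
        (Lf m) ^+ 2 * enorm i_s ^+ 2 / (4 * Rf m) < G_dc m / eta m ^+ 2 ->
      globally_asymptotically_stable (closed_loop m s dv)
        (xi_s, vdc_s, i_s, v_s).
Proof.
have [kappa k0 [d d0 diss]] := uniform_dissipation m s.
exists d => // dv dv0 dvd xi_s vdc_s i_s v_s pe adm.
have {adm} := diss dv dv0 dvd _ pe adm.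
move: (xi_s, vdc_s, i_s, v_s) pe => p pe {}diss.
have a0 := coercivity_gt0 m.
have b0 : 0 < 6 * growth m by rewrite mulr_gt0 ?growth_gt0.
have aH e : coercivity m * `|e| ^+ 2 <= energy m e.
  by have /andP[] := energy_bounds m e.
have Hb e : energy m e <= 6 * growth m * `|e| ^+ 2.
  by have /andP[] := energy_bounds m e.
have dHZ l e v : energy_form m (l *: e) v = l * energy_form m e v.
  by rewrite /energy_form /= !mxE /GRing.scale /=; ring.
have H0 e : energy_form m e (closed_loop m s dv (p + e)) <= 0.
  apply: le_trans (diss e) _; rewrite mulNr oppr_le0 mulr_ge0 ?(ltW k0)//.
  by rewrite !addr_ge0 ?sqr_ge0.
have HdH := has_derivation_energy m.
split=> //.
- exact: (forward_complete_of_dissipative state_coordinates HdH dHZ a0 aH H0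
    (@closed_loop_lipschitz _ m s dv)).
- exact: (lyapunov_stable_of_dissipative HdH a0 b0 aH Hb H0).
- apply: (globally_attractive_of_strict HdH H0) => h.
  have [eps [k k0' [lW decay]]] := strict_decay h k0 pe diss.
  exists (strict_energy m eps), (strict_energy_form m eps), k => //.
  exists (coercivity m) => //; split=> //.
  exact: has_derivation_strict_energy.
Qed.
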